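(* Let $G$ be a sofic group. Every post-surjective cellular automaton on (the full shift over) $G$ is pre-injective (and therefore reversible).
   Context: Let $G$ be a group. A cellular automaton on $G$ (on the full shift $S^G$) is a triple $\mathcal{A} = \langle S, \mathcal{N}, f\rangle$ where $S$ is a finite set with at least two elements, $\mathcal{N}$ is a finite subset of $G$ (the neighborhood), and $f : S^{\mathcal{N}} \to S$ is a function (the local rule). Elements of $S^G$ are called configurations. The global transition function $F : S^G \to S^G$ of $\mathcal{A}$ is defined by: $F(c)(g)$ is the value of $f$ on the function $\mathcal{N} \to S$, $n \mapsto c(gn)$, for every $g \in G$. Two configurations $c, c' \in S^G$ are asymptotic if $\{g \in G : c(g) \neq c'(g)\}$ is finite. $\mathcal{A}$ is pre-injective if any two asymptotic configurations $c, e$ with $F(c) = F(e)$ are equal. $\mathcal{A}$ is post-surjective if for every $e \in S^G$, with $c = F(e)$, and every $c' \in S^G$ asymptotic to $c$, there exists $e' \in S^G$ asymptotic to $e$ with $F(e') = c'$. $\mathcal{A}$ is reversible if $F$ is bijective and $F^{-1}$ is the global transition function of some cellular automaton on $G$ with state set $S$ (the latter condition is automatic when $F$ is bijective). Sofic groups. Let $G$ be finitely generated and let $B$ be a finite symmetric set of generators of $G$. A $B$-labeled graph is a pair $(V,E)$ with $E \subseteq V \times B \times V$; an isomorphism of $B$-labeled graphs is a bijection $\phi$ of the vertex sets such that $(x,\ell,y)$ is an edge iff $(\phi(x),\ell,\phi(y))$ is an edge. The Cayley graph of $G$ with respect to $B$ has vertex set $G$ and edges $(g,x,gx)$, $g \in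 G$, $x \in B$. $D_{B,r}$ is the set of elements of $G$ of word length at most $r$ with respect to $B$, viewed as a labeled graph via the induced subgraph of the Cayley graph. For an integer $r \ge 0$ and a real $\varepsilon > 0$, an $(r,\varepsilon)$-approximation of $G$ relative to $B$ is a finite $B$-labeled graph $(V,E)$ along with a subset $U \subseteq V$ such that: (1) for every $u \in U$, the neighborhood of radius $r$ of $u$ in $(V,E)$ (the subgraph induced on the vertices at path distance at most $r$ from $u$) is isomorphic to $D_{B,r}$ as a labeled graph; (2) $|U| > (1-\varepsilon)|V|$. The finitely generated group $G$ is sofic if for every $r \ge 0$ and $\varepsilon > 0$ there is an $(r,\varepsilon)$-approximation of $G$ relative to $B$; this does not depend on the choice of $B$. *)

(* Defs.v *)
From mathcomp Require Import all_boot all_order all_algebra.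
From mathcomp Require Import finmap.
From mathcomp Require Import boolp classical_sets functions cardinality reals.

Set Implicit Arguments.
Unset Strict Implicit.
Unset Printing Implicit Defensive.

Local Open Scope classical_set_scope.

Record cellular_automaton (G : groupType) (S : finType) := CellularAutomaton {
  ca_states : (1 < #|S|)%N;
  ca_nbhd : {fset G};
  ca_rule : {ffun ca_nbhd -> S} -> S }.

Definition ca_global (G : groupType) (S : finType)
    (A : cellular_automaton G S) (c : G -> S) : G -> S :=
  fun g => ca_rule [ffun n : ca_nbhd A => c (g * fsval n)%g].

Definition asymptotic (G : groupType) (S : finType) (c c' : G -> S) : Prop :=
  finite_set [set g | c g <> c' g].

Definition pre_injective (G : groupType) (S : finType)
    (A : cellular_automaton G S) : Prop :=
  forall c e : G -> S, asymptotic c e -> ca_global A c = ca_global A e -> c = e.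

Definition post_surjective (G : groupType) (S : finType)
    (A : cellular_automaton G S) : Prop :=
  forall e c' : G -> S, asymptotic c' (ca_global A e) ->
    exists e' : G -> S, asymptotic e' e /\ ca_global A e' = c'.

Definition reversible (G : groupType) (S : finType)
    (A : cellular_automaton G S) : Prop :=
  bijective (ca_global A) /\
  exists A' : cellular_automaton G S,
    cancel (ca_global A) (ca_global A') /\ cancel (ca_global A') (ca_global A).

Record labeled_graph (L : Type) := LabeledGraph {
  vertex : Type;
  edge : vertex -> L -> vertex -> Prop }.

Definition induced_subgraph (L : Type) (X : labeled_graph L)
    (A : set (vertex X)) : labeled_graph L :=
  @LabeledGraph L A (fun x l y => edge (val x) l (val y)).

Definition isomorphic (L : Type) (X Y : labeled_graph L) : Prop :=
  exists phi : vertex X -> vertex Y, bijective phi /\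
    forall x l y, edge x l y <-> edge (phi x) l (phi y).

Inductive walk (L : Type) (X : labeled_graph L) :
    nat -> vertex X -> vertex X -> Prop :=
  | walk_nil x : walk 0 x x
  | walk_cons n x l y z : edge x l y -> walk n y z -> walk n.+1 x z.

(* Distances are along directed edges.  For the approximations below,
   undirected distances give the same notion: in a neighborhood isomorphic to a
   ball of the Cayley graph for a symmetric set every edge has a reverse edge,
   and edges without a reverse edge can be discarded. *)
Definition neighborhood (L : Type) (X : labeled_graph L) (r : nat)
    (u : vertex X) : labeled_graph L :=
  induced_subgraph [set v | exists2 n, (n <= r)%N & walk n u v].

Definition finite_labeled_graph (L V : finType) (E : {set V * L * V}) :
    labeled_graph L :=
  @LabeledGraph L V (fun x l y => (x, l, y) \in E).

Definition symmetric_fset (G : groupType) (B : {fset G}) : Prop :=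
  forall x : G, x \in B -> x^-1%g \in B.

Definition word_value (G : groupType) (B : {fset G}) (w : seq B) : G :=
  \big[*%g/1%g]_(x <- w) fsval x.

(* Inverse letters are not needed: B is symmetric wherever this is used. *)
Definition generates (G : groupType) (B : {fset G}) : Prop :=
  forall g : G, exists w : seq B, word_value w = g.

Definition cayley_graph (G : groupType) (B : {fset G}) : labeled_graph B :=
  @LabeledGraph B G (fun g x h => h = (g * fsval x)%g).

Definition word_ball (G : groupType) (B : {fset G}) (r : nat) : set G :=
  [set g | exists2 w : seq B, (size w <= r)%N & word_value w = g].

Definition cayley_ball (G : groupType) (B : {fset G}) (r : nat) :
    labeled_graph B :=
  @induced_subgraph B (cayley_graph B) (word_ball B r).

(* The isomorphisms are not required to send u to 1.  This loses nothing: if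
   all of the ball of radius r lies within distance r of some element g of it,
   then left translation by g is an automorphism of the ball. *)
Definition is_approximation (R : realType) (G : groupType) (B : {fset G})
    (r : nat) (eps : R) (V : finType) (E : {set V * B * V}) (U : {set V}) :
    Prop :=
  (forall u : V, u \in U ->
     isomorphic (@neighborhood _ (finite_labeled_graph E) r u)
                (cayley_ball B r)) /\
  ((1 - eps) * #|V|%:R < #|U|%:R)%R.

(* Finite generation is part of the notion.  The set B is quantified
   existentially, as the approximation property does not depend on it. *)
Definition sofic (R : realType) (G : groupType) : Prop :=
  exists B : {fset G}, [/\ symmetric_fset B, generates B &
    forall (r : nat) (eps : R), (0 < eps)%R ->
      exists (V : finType) (E : {set V * B * V}) (U : {set V}),
        is_approximation r eps E U].

(* Main.v *)
Require Import Defs.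
From mathcomp Require Import boolp classical_sets cardinality filter.
From mathcomp Require Import all_boot all_algebra reals.
From mathcomp Require Import finmap zify.
Import GRing.Theory Num.Theory.

Set Implicit Arguments.
Unset Strict Implicit.
Unset Printing Implicit Defensive.

(** Let F be the global map, with neighborhood N.

    Post-surjectivity is uniform ([correction_window]): by compactness there is
    one finite set M such that, whatever the configuration e, the value of F e
    at a single cell p can be changed at will, and nowhere else, by changing e
    on p M only.

    Post-surjective and pre-injective maps are reversible, over any group
    ([preinjective_reversible]).  If F e and F e' agree on M^-1, graft a large
    patch of e' around 1 into e.  The image of the result differs from F e at
    finitely many cells, all outside M^-1; correct these one by one.  No
    correction touches the cell 1, and the configuration reached is asymptotic
    to e with the same image, hence is e.  So e 1 = e' 1: the value at a cell is
    a function of finitely many values of the image, which is the local rule of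
    the inverse.

    Over a sofic group, post-surjectivity implies pre-injectivity
    ([sofic_post_surjective_pre_injective]) because a finite model turns the
    failure of one into a counting contradiction with the other.  Soficity gives
    a finite set V on which G acts approximately: a prescribed finite part of G
    acts freely and multiplicatively at all points of a set U whose complement
    in V is as small as desired relative to U ([sofic_locally_acts]).  The
    local rule then induces a map from patterns on V to patterns on U.
    - This map is onto: correct the value at one point of U after the other,
      each time inside the window M transported to that point
      ([model_global_surjective]).
    - If c <> e are asymptotic with F c = F e, an occurrence in V of a large
      enough finite pattern of c can be replaced by the matching pattern of e
      without changing the image on U ([erase_pattern]).  Hence the patterns
      that avoid c at every point of some W in U already reach all of S^U.  When
      the windows at the points of W are disjoint, those patterns form at most a
      fraction (1 - 1/Q)^|W| of all patterns, Q being the number of patterns on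
      one window ([card_avoiders]), and W can be a fixed fraction of U
      ([packing]).
    So |S|^|U| <= |S|^|V| (1 - 1/Q)^|W| with |W| of the order of |V|, which is
    absurd once |V| - |U| is a small enough fraction of |V|
    ([counting_contradiction]). *)

(** * Configurations, neighborhoods and compactness *)

(** Compactness of S^T in the form of a cluster point for a net indexed by the
    finite subsets of T.  The limit is taken pointwise along an ultrafilter
    that refines the cofinal sections: S being finite, exactly one value at each
    point is taken on a large set of indices. *)
Lemma cluster_configuration (T : choiceType) (S : finType)
    (c_ : {fset T} -> T -> S) :
  exists c : T -> S, forall M D : {fset T},
    exists2 M', (M `<=` M')%fset & {in D, c_ M' =1 c}.
Proof.
pose F : set_system {fset T} :=
  fun A => exists M, forall M', (M `<=` M')%fset -> A M'.
have FF : ProperFilter F.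
  apply: Build_ProperFilter_ex.
    by move=> A [M AM]; exists M; apply: AM; apply: fsubset_refl.
  split; first by exists fset0.
  - move=> A B [M AM] [N BN]; exists (M `|` N)%fset => M'.
    by rewrite fsubUset => /andP[/AM ? /BN ?]; split.
  - by move=> A B AB [M AM]; exists M => M' /AM /AB.
have [U [UU FU]] := ultraFilterLemma FF.
have limc g : exists s, U (fun M => c_ M g = s).
  apply: contrapT => /forallNP noS.
  have : U (fun M => forall s, c_ M g <> s).
    apply: filter_forall => s.
    by have [/noS|] := in_ultra_setVsetC (fun M => c_ M g = s) UU.
  by move=> /filter_ex[M /(_ (c_ M g))].
have [c Uc] := choice limc.
exists c => M D.
have UM : U (fun M' => (M `<=` M')%fset) by apply: FU; exists M.
have UD : U (fun M' => forall g, g \in D -> c_ M' g = c g).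
  by apply: (@filter_bigI _ _ D (fun g M' => c_ M' g = c g)) => g _; exact: Uc.
have [M' [MM' DM']] := filter_ex (filterI UM UD).
by exists M' => // g gD; apply: DM'.
Qed.

Definition fset_mulg (G : groupType) (X Y : {fset G}) : {fset G} :=
  [fset (x * y)%g | x in X, y in Y]%fset.

Definition fset_invg (G : groupType) (X : {fset G}) : {fset G} :=
  [fset x^-1%g | x in X]%fset.

Lemma fset_mulgP (G : groupType) (X Y : {fset G}) x y :
  x \in X -> y \in Y -> (x * y)%g \in fset_mulg X Y.
Proof. by move=> xX yY; apply: in_imfset2. Qed.

Lemma fset_invgP (G : groupType) (X : {fset G}) x :
  x \in X -> x^-1%g \in fset_invg X.
Proof. by move=> xX; apply: in_imfset. Qed.

Lemma asymptotic_eq_off (G : groupType) (S : finType) (D : {fset G})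
    (c c' : G -> S) : (forall g, g \notin D -> c g = c' g) -> asymptotic c c'.
Proof.
move=> cD; apply: (sub_finite_set _ (finite_fset D)) => g /= cg.
by apply: contra_notT cg => /cD.
Qed.

Lemma asymptotic_trans (G : groupType) (S : finType) (c1 c2 c3 : G -> S) :
  asymptotic c1 c2 -> asymptotic c2 c3 -> asymptotic c1 c3.
Proof.
move=> c12 c23.
have : finite_set ([set g | c1 g <> c2 g] `|` [set g | c2 g <> c3 g])%classic.
  by rewrite finite_setU.
apply: sub_finite_set => g /= c13.
by have [c12g|] := eqVneq (c1 g) (c2 g); [right; rewrite -c12g|move/eqP; left].
Qed.

Lemma asymptotic_support (G : groupType) (S : finType) (c c' : G -> S) :
  asymptotic c c' ->
  exists D : {fset G}, forall g, (g \in D) = (c g != c' g).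
Proof.
move=> fin; exists (fset_set [set g | c g <> c' g]%classic) => g.
rewrite in_fset_set //; apply/idP/idP => [|/eqP cg]; last by apply: mem_set.
by move=> /set_mem/eqP.
Qed.

Section LocalRule.
Variables (G : groupType) (S : finType) (A : cellular_automaton G S).
Local Notation F := (ca_global A).
Local Notation N := (ca_nbhd A).
Implicit Types (c e : G -> S) (g p : G) (D M W : {fset G}).

Lemma ca_global_local c c' g g' :
  {in N, forall n, c (g * n)%g = c' (g' * n)%g} -> F c g = F c' g'.
Proof.
move=> cc'; rewrite /ca_global; congr (ca_rule _).
by apply/ffunP => n; rewrite !ffunE; apply: cc'; apply: fsvalP.
Qed.

Lemma ca_global_shift c p g : F (fun h => c (p * h)%g) g = F c (p * g)%g.
Proof. by apply: ca_global_local => n _; rewrite mulgA. Qed.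

(** The cells where the image may change when a configuration is changed on D
    ([affectedP]). *)
Definition affected D : {fset G} := fset_mulg D (fset_invg N).

Definition halo D : {fset G} := fset_mulg (affected D) N.

Lemma affectedP D g n : n \in N -> (g * n)%g \in D -> g \in affected D.
Proof.
by move=> nN gnD; rewrite -(mulgK n g) fset_mulgP // fset_invgP.
Qed.

Lemma haloP D g n : g \in affected D -> n \in N -> (g * n)%g \in halo D.
Proof. by move=> gD nN; apply: fset_mulgP. Qed.

Lemma ca_global_unaffected D c c' g :
  (forall h, h \notin D -> c h = c' h) -> g \notin affected D -> F c g = F c' g.
Proof.
move=> cD gD; apply: ca_global_local => n nN; apply: cD.
by apply: contra gD; apply: affectedP.
Qed.

(** * Uniform corrections *)

(** The cell 1 stands for an arbitrary cell, by translation ([correct_at]). *)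
Definition corrects_within M : Prop := forall e s, exists e',
  (forall g, g \notin M -> e' g = e g) /\
  forall g, F e' g = if g == 1%g then s else F e g.

(** If no M worked, a cluster point x of counterexamples x_M would still have a
    correction, on some finite M.  Correctness of that correction only involves
    finitely many cells W, where x agrees with some x_M' with M included in M': so the
    same change corrects x_M' within M', a contradiction.  The second component
    of a counterexample carries the requested value, so that the limit
    selects it as well. *)
Lemma correction_window : post_surjective A -> exists M, corrects_within M.
Proof.
move=> Apost; apply: contrapT => /forallNP noM.
pose bad (M : {fset G}) (x : G -> S * S) := ~ exists e' : G -> S,
  (forall g, g \notin M -> e' g = (x g).1) /\
  forall g, F e' g = if g == 1%g then (x 1%g).2 else F (fun h => (x h).1) g.
have /choice[x_ bad_x] : forall M, exists x, bad M x.
  move=> M; have /existsNP[e /existsNP[s nes]] := noM M.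
  by exists (fun g => (e g, s)).
have [x xP] := cluster_configuration x_.
pose e g := (x g).1; pose s := (x 1%g).2.
have [|e' [asym_e' Fe']] := Apost e (fun g => if g == 1%g then s else F e g).
  apply: (@asymptotic_eq_off _ _ [fset 1%g]%fset) => g.
  by rewrite in_fset1; case: eqP.
have [M MP] := asymptotic_support asym_e'.
pose W := (halo M `|` (M `|` (N `|` [fset 1%g])))%fset.
have [M' MM' xM'] := xP M W.
have eqW g : g \in W -> x_ M' g = x g by exact: xM'.
pose e1 g := if g \in M then e' g else (x_ M' g).1.
apply: (bad_x M'); exists e1; split=> [g gM'|g].
  by rewrite /e1 ifN //; apply: contra gM'; exact: (fsubsetP MM').
have -> : (x_ M' 1%g).2 = s by rewrite eqW // !inE eqxx !orbT.
have e1W h : h \in W -> e1 h = e' h.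
  move=> hW; rewrite /e1; case: ifPn => // hM; rewrite eqW //.
  by move: hM; rewrite MP negbK => /eqP ->.
have [->|g1] := eqVneq g 1%g.
  transitivity (F e' 1%g); last by rewrite Fe' eqxx.
  apply: ca_global_local => n nN; rewrite mul1g e1W //.
  by rewrite !inE nN !orbT.
have [gM|gM] := boolP (g \in affected M); last first.
  by apply: ca_global_unaffected gM => h hM; rewrite /e1 ifN.
have gW n : n \in N -> (g * n)%g \in W by move=> nN; rewrite inE haloP.
transitivity (F e' g); first by apply: ca_global_local => n /gW; exact: e1W.
rewrite Fe' (negPf g1); apply: ca_global_local => n /gW gnW.
by rewrite eqW.
Qed.

Lemma correct_at M : corrects_within M -> forall e p s, exists e',
    (forall g, (p^-1 * g)%g \notin M -> e' g = e g) /\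
    forall g, F e' g = if g == p then s else F e g.
Proof.
move=> corr e p s; have [e' [e'M Fe']] := corr (fun h => e (p * h)%g) s.
exists (fun g => e' (p^-1 * g)%g); split=> [g /e'M ->|g]; first by rewrite mulVKg.
rewrite ca_global_shift Fe' ca_global_shift mulVKg.
by rewrite -(inj_eq (mulgI p)) mulVKg mulg1.
Qed.

Lemma correct_along M (d : G -> S) (l : seq G) e : corrects_within M ->
  {in l, forall p, p \notin fset_invg M} ->
  exists e', [/\ asymptotic e' e, e' 1%g = e 1%g &
    forall g, F e' g = if g \in l then d g else F e g].
Proof.
move=> corr; elim: l => [|p l IH] lM.
  by exists e; split=> //; apply: (@asymptotic_eq_off _ _ fset0).
have [|e1 [e1e e11 Fe1]] := IH; first by move=> g gl; apply: lM; rewrite inE gl orbT.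
have [e2 [e21 Fe2]] := correct_at corr e1 p (d p).
exists e2; split.
- apply: asymptotic_trans e1e.
  apply: (@asymptotic_eq_off _ _ (fset_mulg [fset p]%fset M)) => g gpM.
  apply: e21; apply: contra gpM => pgM.
  by rewrite -(mulVKg p g) fset_mulgP // in_fset1.
- rewrite e21 // mulg1; apply: contra (lM p (mem_head _ _)) => pM.
  by rewrite -(invgK p) fset_invgP.
- by move=> g; rewrite Fe2 Fe1 inE; case: eqP => [->|].
Qed.

(** * Reversibility *)

(** The graft e2 carries e' on W, which contains 1 and all cells that F consults
    to compute its values on M^-1, and carries e elsewhere.  All the cells where
    F e2 differs from F e are outside M^-1, so correcting them does not disturb
    the cell 1. *)
Lemma image_determines M : corrects_within M -> pre_injective A ->
  forall e e' g,
    {in fset_invg M, forall k, F e (g * k)%g = F e' (g * k)%g} -> e g = e' g.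
Proof.
move=> corr Apre.
suff det1 e e' : {in fset_invg M, F e =1 F e'} -> e 1%g = e' 1%g.
  move=> e e' g eqK; rewrite -(mulg1 g).
  apply: (det1 (fun h => e (g * h)%g) (fun h => e' (g * h)%g)) => k kK.
  by rewrite !ca_global_shift eqK.
move=> eqK; pose W := ([fset 1%g] `|` fset_mulg (fset_invg M) N)%fset.
pose e2 g := if g \in W then e' g else e g.
have e2W g : g \notin W -> e2 g = e g by move=> gW; rewrite /e2 ifN.
have e2e : asymptotic (F e2) (F e).
  apply: (@asymptotic_eq_off _ _ (affected W)) => g.
  exact: ca_global_unaffected.
have e2K : {in fset_invg M, F e2 =1 F e}.
  move=> g gK; rewrite eqK //; apply: ca_global_local => n nN.
  by rewrite /e2 ifT // inE fset_mulgP // orbT.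
have [D DP] := asymptotic_support e2e.
have [|e3 [e3e2 e31 Fe3]] := @correct_along M (F e) D e2 corr.
  by move=> p; rewrite DP; apply: contra => /e2K ->.
have <- : e3 = e.
  apply: Apre; first exact: asymptotic_trans e3e2 (asymptotic_eq_off e2W).
  apply: funext => g; rewrite Fe3.
  by case: ifPn => //; rewrite DP negbK => /eqP.
by rewrite e31 /e2 ifT // inE in_fset1 eqxx.
Qed.

Lemma preinjective_reversible :
  post_surjective A -> pre_injective A -> reversible A.
Proof.
move=> Apost Apre; have [M corr] := correction_window Apost.
pose K := fset_invg M; have det := image_determines corr Apre.
have [s0 _] : exists s0 : S, s0 \in S.
  by have /ltnW/card_gt0P := ca_states A.
(* By image_determines the value below does not depend on the chosen e; s0 is
   the value on patterns that do not occur in the image. *)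
pose inv_rule (p : {ffun K -> S}) : S :=
  if pselect (exists e, forall k : K, F e (fsval k) = p k) is left ex
  then sval (cid ex) 1%g else s0.
pose A' := CellularAutomaton (ca_states A) inv_rule.
have A'P c e g : {in K, forall k, F e (g * k)%g = c (g * k)%g} ->
    ca_global A' c g = e g.
  move=> eK; rewrite /ca_global /= /inv_rule.
  case: pselect => [ex|[]].
    case: cid => e' /= e'P; rewrite -[in RHS](mulg1 g).
    apply: (det e' (fun h => e (g * h)%g)) => k kK.
    rewrite mul1g ca_global_shift eK // (e'P [` kK]%fset) ffunE //.
  exists (fun h => e (g * h)%g) => k.
  by rewrite ca_global_shift ffunE eK //; apply: fsvalP.
have FK : cancel F (ca_global A').
  by move=> e; apply: funext => g; apply: A'P.
have KF : cancel (ca_global A') F.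
  move=> c; apply: funext => g.
  (* Only the values of c on W matter at g; post-surjectivity realizes them in
     the image of a configuration asymptotic to a constant one. *)
pose W := (fset_mulg (fset_mulg [fset g] N) K `|` [fset g])%fset.
  pose c' h := if h \in W then c h else F (fun=> s0) h.
  have [|e [_ Fe]] := Apost (fun=> s0) c'.
    by apply: (@asymptotic_eq_off _ _ W) => h hW; rewrite /c' ifN.
  transitivity (F e g).
    apply: ca_global_local => n nN; apply: A'P => k kK.
    rewrite Fe /c' ifT // inE; apply/orP; left.
    by do !apply: fset_mulgP => //; rewrite in_fset1.
  by rewrite Fe /c' ifT // !inE eqxx orbT.
by split; [exists (ca_global A') | exists A'].
Qed.

End LocalRule.

(** * Sofic groups act approximately on finite sets *)

(** From every point u of U, V looks like the part K of the Cayley graph of G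
    seen from 1, the point sg a u playing the role of a; letters act on the
    right, which explains the order in sg (a * b).  The points sg a u may leave
    U: only their relation to u is prescribed. *)
Definition locally_acts (G : groupType) (V : finType) (sg : G -> V -> V)
    (K : {fset G}) (U : {set V}) : Prop :=
  forall u, u \in U ->
    [/\ sg 1%g u = u,
        {in K &, forall a b, sg b (sg a u) = sg (a * b)%g u} &
        {in K &, injective (sg^~ u)}].

Section Chart.
Variables (G : groupType) (B : {fset G}) (r : nat) (V : finType).
Variables (E : {set V * B * V}) (u : V).

Local Notation X := (finite_labeled_graph E).
Local Notation ball := (@neighborhood _ X r u).

Lemma walk_rcons n (x y z : V) l :
  @walk _ X n x y -> (y, l, z) \in E -> @walk _ X n.+1 x z.
Proof.
elim=> {n x y} [x|n x l' y y' xy _ IH] yz.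
  by apply: (@walk_cons _ X 0 x l z z) => //; apply: walk_nil.
by apply: walk_cons xy (IH yz).
Qed.

Lemma word_value_rcons (w : seq B) l :
  word_value (rcons w l) = (word_value w * fsval l)%g.
Proof. by rewrite /word_value -cats1 big_cat big_seq1. Qed.

(** The isomorphism may send u to some g <> 1, so it has to be composed with the
    left translation by g^-1.  This is legitimate because the ball D is stable
    under left translation by g: every point of the neighborhood is reached by a
    short walk from u, whence D is included in g D, and both are finite with the
    same number of elements.  For the same reason of walk length, an edge that
    leaves a point at distance less than r from u stays in the neighborhood, so
    that it is determined by its label. *)
Lemma neighborhood_chart : isomorphic ball (cayley_ball B r) ->
  exists psi : G -> V,
    [/\ psi 1%g = u,
        forall a b, word_ball B r a -> word_ball B r b -> psi a = psi b -> a = b &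
        forall (w : seq B) (l : B), (size w < r)%N ->
          forall y, (psi (word_value w), l, y) \in E <->
                    y = psi (word_value w * fsval l)%g].
Proof.
case=> phi [[psi0 phiK psi0K] phiE].
pose N v := exists2 n, (n <= r)%N & @walk _ X n u v.
pose D := word_ball B r.
pose h v : G := if pselect (N v) is left Nv
  then val (phi (exist _ v (mem_set Nv))) else 1%g.
pose k a : V := if pselect (D a) is left Da
  then val (psi0 (exist _ a (mem_set Da))) else u.
have hE (x : vertex ball) : h (val x) = val (phi x).
  have Nx : N (val x) by apply: set_mem (valP x).
  rewrite /h; case: pselect => // Nx'; congr (val (phi _)); exact: val_inj.
have kE (a : vertex (cayley_ball B r)) : k (val a) = val (psi0 a).
  have Da : D (val a) by apply: set_mem (valP a).
  rewrite /k; case: pselect => // Da'; congr (val (psi0 _)); exact: val_inj.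
(* h and k carry phi and psi0 over to V and G, so that no point of a subtype
   has to be handled below. *)
have NX v : N v -> exists x : vertex ball, val x = v.
  by move=> Nv; exists (exist _ v (mem_set Nv)).
have DX a : D a -> exists x : vertex (cayley_ball B r), val x = a.
  by move=> Da; exists (exist _ a (mem_set Da)).
have hD v : N v -> D (h v).
  by move=> /NX[x <-]; rewrite hE; apply: set_mem (valP (phi x)).
have kN a : D a -> N (k a).
  by move=> /DX[x <-]; rewrite kE; apply: set_mem (valP (psi0 x)).
have hK v : N v -> k (h v) = v.
  by move=> /NX[x <-]; rewrite hE kE phiK.
have kK a : D a -> h (k a) = a.
  by move=> /DX[x <-]; rewrite kE hE psi0K.
have hEdge v w l : N v -> N w -> (v, l, w) \in E <-> h w = (h v * fsval l)%g.
  by move=> /NX[x <-] /NX[y <-]; rewrite !hE; exact: (phiE x l y).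
have Nu : N u by exists 0 => //; apply: walk_nil.
pose g := h u.
have Dg v : N v -> D (g^-1 * h v)%g.
  case=> n nr; rewrite /D /word_ball /=.
  suff : forall m x y, @walk _ X m x y -> forall p, @walk _ X p u x ->
      (p + m <= r)%N ->
      exists2 w : seq B, size w = m & h y = (h x * word_value w)%g.
    move=> H uv; have [w sw ->] := H _ _ _ uv 0 (walk_nil (X := X) u) nr.
    by exists w; rewrite ?sw // mulKg.
  move=> m x y; elim=> {m x y} [x|m x l y z xy _ IH] p ux pr.
    by exists [::] => //; rewrite /word_value big_nil mulg1.
  have uy := walk_rcons ux xy.
  have [|w sw ->] := IH _ uy; first by rewrite addSnnS.
  exists (l :: w); first by rewrite /= sw.
  have -> : h y = (h x * fsval l)%g.
    apply/hEdge => //.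
      by exists p => //; apply: leq_trans pr; apply: leq_addr.
    exists p.+1 => //; apply: leq_trans pr; rewrite addnS ltnS.
    exact: leq_addr.
  by rewrite /word_value big_cons mulgA.
have gD a : D a -> D (g * a)%g.
  move=> Da.
  (* Translation by g^-1, transported to V, is an injection of a finite type,
     hence onto. *)
  pose f v := if pselect (N v) is left Nv then k (g^-1 * h v)%g else v.
  have f_inj : injective f.
    move=> v w; rewrite /f; case: pselect => Nv; case: pselect => Nw //.
    - move=> /(congr1 h); rewrite !kK; [|exact: Dg..].
      by move=> /mulgI /(congr1 k); rewrite !hK.
    - by move=> kw; case: Nw; rewrite -kw; apply/kN/Dg.
    - by move=> kw; case: Nv; rewrite kw; apply/kN/Dg.
  have /codomP[v /esym] := injF_onto f_inj (k a).
  rewrite /f; case: pselect => [Nv /(congr1 h)|Nv kv].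
    by rewrite !kK //; [move=> <-; rewrite mulVKg; exact: hD|exact: Dg].
  by case: Nv; rewrite kv; exact: kN.
pose psi a := k (g * a)%g.
have psi1 : psi 1%g = u by rewrite /psi mulg1 hK.
have Dw (w : seq B) : (size w <= r)%N -> D (word_value w) by exists w.
have psiE (w : seq B) l : (size w < r)%N ->
    (psi (word_value w), l, psi (word_value w * fsval l)%g) \in E.
  move=> wr; have := Dw _ (ltnW wr) => Dw1.
  have : D (word_value w * fsval l)%g.
    by rewrite -word_value_rcons; apply: Dw; rewrite size_rcons.
  move=> Dw2; apply/hEdge; [exact/kN/gD..|].
  by rewrite !kK; [rewrite mulgA|exact: gD..].
have psiW (w : seq B) : (size w <= r)%N -> @walk _ X (size w) u (psi (word_value w)).
  elim/last_ind: w => [|w l IH]; first by rewrite /word_value big_nil psi1; constructor.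
  rewrite size_rcons word_value_rcons => wr.
  exact: walk_rcons (IH (ltnW wr)) (psiE _ _ wr).
exists psi; split=> //.
  by move=> a b Da Db /(congr1 h); rewrite !kK; [move=> /mulgI|exact: gD..].
move=> w l wr y; split=> [wy|->]; last exact: psiE.
have Ny : N y by exists (size w).+1 => //; exact: walk_rcons (psiW _ (ltnW wr)) wy.
have Npsi : N (psi (word_value w)) by apply/kN/gD/Dw/ltnW.
move/hEdge: wy => /(_ Npsi Ny); rewrite kK; last exact/gD/Dw/ltnW.
by rewrite /psi mulgA => <-; rewrite hK.
Qed.

End Chart.

(** The element a acts by following the edges labeled by a fixed word wd a for a.
    At u in U, along words of length at most r, this is computed in the Cayley
    graph; r = L + L leaves room for two words in succession. *)
Lemma sofic_locally_acts (R : realType) (G : groupType) : sofic R G ->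
  forall (K : {fset G}) (m : nat),
    exists (V : finType) (U : {set V}) (sg : G -> V -> V),
      locally_acts sg K U /\ (m * #|V| < m.+1 * #|U|)%N.
Proof.
case=> B [_ /choice[wd wdK] approx] K m.
pose K' := (K `|` (fset_mulg K K `|` [fset 1%g]))%fset.
pose L := (\max_(a : K') size (wd (fsval a)))%N.
have wdL a : a \in K' -> (size (wd a) <= L)%N.
  by move=> aK'; exact: (leq_bigmax [` aK']%fset).
have [|V [E [U [UE Ucard]]]] := approx (L + L)%N (m.+1%:R^-1)%R.
  by rewrite invr_gt0 ltr0Sn.
pose step v l := if [pick y | (v, l, y) \in E] is Some y then y else v.
exists V, U, (fun a v => foldl step v (wd a)); split; last first.
  rewrite -(ltr_nat R) !natrM.
  have : (m.+1%:R * ((1 - m.+1%:R^-1) * #|V|%:R) < m.+1%:R * #|U|%:R :> R)%R.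
    by rewrite ltr_pM2l // ltr0Sn.
  by rewrite mulrA mulrBr mulr1 divff ?pnatr_eq0 // -[X in (X - _)%R]natr1 addrK.
move=> u /UE /neighborhood_chart [psi [psi1 psi_inj psiE]].
have fold_psi (w : seq B) : (size w <= L + L)%N ->
    foldl step u w = psi (word_value w).
  elim/last_ind: w => [|w l IH]; first by rewrite /word_value big_nil psi1.
  rewrite size_rcons word_value_rcons -cats1 foldl_cat /= => wr.
  rewrite IH; last exact: ltnW.
  rewrite /step; case: pickP => [y|/(_ (psi (word_value w * fsval l)%g)) /negP[]].
    by move=> /psiE ->.
  by apply/psiE.
have actE a : a \in K' -> foldl step u (wd a) = psi a.
  move=> /wdL aL; rewrite fold_psi ?wdK //.
  by apply: leq_trans aL _; apply: leq_addr.
split.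
- by rewrite actE ?psi1 // !inE eqxx !orbT.
- move=> a b aK bK; rewrite -foldl_cat fold_psi; last first.
    by rewrite size_cat leq_add // wdL // inE ?aK ?bK.
  rewrite actE; last by rewrite !inE fset_mulgP ?orbT.
  by rewrite /word_value big_cat /= -!/(word_value _) !wdK.
- move=> a b aK bK; rewrite !actE ?inE ?aK ?bK //.
  apply: psi_inj.
    exists (wd a) => //; apply: leq_trans (leq_addr _ _); apply: wdL.
    by rewrite inE aK.
  exists (wd b) => //; apply: leq_trans (leq_addr _ _); apply: wdL.
  by rewrite inE bK.
Qed.

(** * Counting patterns *)

Definition avoiders (I : eqType) (T V S : finType) (j : I -> T -> V) (p : T -> S)
    (s : seq I) : {set {ffun V -> S}} :=
  [set x : {ffun V -> S} | all (fun w => ~~ [forall a, x (j w a) == p a]) s].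

(** Forbidding p at one more place w multiplies the count by at most 1 - 1/Q,
    where Q is the number of patterns on T: overwriting the window of w by p
    does not affect the other windows and is at most Q-to-one, so at least one
    in Q of the patterns that avoid p at the places of s shows p at w. *)
Lemma card_avoiders (I : eqType) (T V S : finType) (j : I -> T -> V) (p : T -> S)
    (s : seq I) : uniq s ->
  {in s, forall w, injective (j w)} ->
  {in s &, forall w w', w != w' -> forall a b, j w a != j w' b} ->
  (#|avoiders j p s| * #|{ffun T -> S}| ^ size s <=
   #|{ffun V -> S}| * #|{ffun T -> S}|.-1 ^ size s)%N.
Proof.
elim: s => [|w s IH] /=; first by rewrite !expn0 !muln1 => *; exact: max_card.
move=> /andP[ws us] jI jD.
have {}IH : (#|avoiders j p s| * #|{ffun T -> S}| ^ size s <=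
   #|{ffun V -> S}| * #|{ffun T -> S}|.-1 ^ size s)%N.
  apply: IH => //.
    by move=> w' w's; apply: jI; rewrite inE w's orbT.
  by move=> w1 w2 w1s w2s; apply: jD; rewrite inE ?w1s ?w2s orbT.
set Q := #|{ffun T -> S}| in IH *.
pose Y := [set x in avoiders j p s | [forall a, x (j w a) == p a]].
have avE : avoiders j p (w :: s) = avoiders j p s :\: Y.
  by apply/setP => x; rewrite !inE /=; case: all; rewrite ?andbT ?andbF.
have YsX : Y \subset avoiders j p s by apply/subsetP => x; rewrite inE => /andP[].
have cardY : (#|avoiders j p s| <= #|Y| * Q)%N.
  pose ow (x : {ffun V -> S}) : {ffun V -> S} :=
    [ffun v => if [pick a | j w a == v] is Some a then p a else x v].
  pose f x := (ow x, [ffun a => x (j w a)] : {ffun T -> S}).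
  have f_inj : injective f.
    move=> x y [/ffunP oxy /ffunP jxy]; apply/ffunP => v.
    have := oxy v; rewrite !ffunE; case: pickP => // a /eqP <- _.
    by have := jxy a; rewrite !ffunE.
  rewrite -(card_imset _ f_inj) /Q -[#|{ffun T -> S}|]cardsT -cardsX.
  apply/subset_leq_card/subsetP => _ /imsetP[x xX ->].
  rewrite !inE /= andbT; apply/andP; split.
    move: xX; rewrite inE => /allP xs; apply/allP => w' w's.
    have := xs _ w's; apply: contra => /forallP ow_p; apply/forallP => a.
    have := ow_p a; rewrite ffunE; case: pickP => // b /eqP jb.
    have ww' : w != w' by apply: contraNneq ws => ->.
    have := jD w w'; rewrite mem_head inE w's orbT => /(_ isT isT ww' b a).
    by rewrite jb eqxx.
  apply/forallP => a; rewrite ffunE; case: pickP => [b /eqP|/(_ a)].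
    by move=> /(jI w (mem_head _ _)) ->.
  by rewrite eqxx.
rewrite avE cardsD (setIidPr YsX) !expnS.
have step : ((#|avoiders j p s| - #|Y|) * Q <= #|avoiders j p s| * Q.-1)%N.
  rewrite mulnBl -subn1 mulnBr muln1.
  exact: leq_sub2l.
rewrite mulnA (leq_trans (leq_mul step (leqnn _))) //.
by rewrite mulnAC [leqRHS]mulnCA [leqRHS]mulnC leq_mul2r IH orbT.
Qed.

(** Bernoulli's inequality in the form n^t + t n^(t-1) <= (n + 1)^t, with
    n = Q - 1. *)
Lemma growth_gap (q Q t : nat) : (0 < q)%N -> (1 < Q)%N -> (q * Q <= t)%N ->
  (q * Q.-1 ^ t < Q ^ t)%N.
Proof.
case: Q => // Q q0 Q0 qt; rewrite ltnS in Q0; rewrite [Q.+1.-1]/=.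
have t0 : (0 < t)%N by apply: leq_trans qt; rewrite muln_gt0 q0.
have bern n : (Q ^ n.+1 + n.+1 * Q ^ n <= Q.+1 ^ n.+1)%N.
  elim: n => [|n IH]; first by rewrite !expn1 expn0 mul1n addn1.
  rewrite [X in (_ <= X)%N]expnS.
  apply: leq_trans (leq_mul (leqnn Q.+1) IH).
  by rewrite !expnS; move: (Q ^ n)%N => z; nia.
case: t t0 qt => // t _ qt; apply: leq_trans (bern t).
have Qt : (0 < Q ^ t)%N by rewrite expn_gt0 Q0.
rewrite expnS mulnA -mulnDl ltn_mul2r Qt /=; lia.
Qed.

(** With t = q Q and v - u < u / (t k) <= w / t, taking the t-th power of
    Q^w <= q^(v - u) (Q - 1)^w and then the w-th root gives
    Q^t <= q (Q - 1)^t, against [growth_gap]. *)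
Lemma counting_contradiction (q Q k u v w a : nat) : (0 < q)%N -> (1 < Q)%N ->
  (u <= v)%N -> (q ^ u <= a)%N -> (a * Q ^ w <= q ^ v * Q.-1 ^ w)%N ->
  (u <= w * k)%N -> (q * Q * k * v < (q * Q * k).+1 * u)%N -> False.
Proof.
move=> q0 Q1 uv qa aQ uwk card; have gap := growth_gap q0 Q1 (leqnn _).
set t := (q * Q)%N in gap card.
have tw : (t * (v - u) < w)%N.
  have k0 : (0 < k)%N by case: k uwk card => //; rewrite muln0; lia.
  rewrite -(ltn_pmul2r k0); apply: leq_trans uwk.
  by rewrite mulnAC mulnBr; lia.
have w0 : (0 < w)%N by apply: leq_trans tw.
have Qw : (Q ^ w <= q ^ (v - u) * Q.-1 ^ w)%N.
  have qu0 : (0 < q ^ u)%N by rewrite expn_gt0 q0.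
  rewrite -(leq_pmul2l qu0) mulnA -expnD subnKC //.
  by apply: leq_trans aQ; rewrite leq_mul2r qa orbT.
have : ((q * Q.-1 ^ t) ^ w < (Q ^ t) ^ w)%N by rewrite ltn_exp2r.
rewrite ltnNge => /negP[]; rewrite -expnM mulnC expnM.
have t0 : (0 < t)%N by rewrite muln_gt0 q0 ltnW.
have : ((Q ^ w) ^ t <= (q ^ (v - u) * Q.-1 ^ w) ^ t)%N by rewrite leq_exp2r.
move=> /leq_trans; apply; rewrite !expnMn -!expnM [(w * t)%N]mulnC.
by rewrite leq_mul2r leq_pexp2l ?orbT // mulnC ltnW.
Qed.

(** * The automaton on a finite model *)

Section Model.
Variables (G : groupType) (S : finType) (A : cellular_automaton G S).
Local Notation F := (ca_global A).
Local Notation N := (ca_nbhd A).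
Variables (V : finType) (sg : G -> V -> V) (K : {fset G}) (U : {set V}).
Hypothesis sgU : locally_acts sg K U.
Hypotheses (NK : (N `<=` K)%fset) (NVK : (fset_invg N `<=` K)%fset)
  (K1 : 1%g \in K).
Implicit Types (x y : V -> S) (e : G -> S) (D : {fset G}) (u v : V).

Definition pullback x v : G -> S := fun g => x (sg g v).

Definition model_global x v : S := F (pullback x v) 1%g.

Definition paste x u e D v : S :=
  if [pick a : D | sg (fsval a) u == v] is Some a then e (fsval a) else x v.

Lemma paste_outside x u e D v :
  (forall a, a \in D -> sg a u != v) -> paste x u e D v = x v.
Proof.
move=> vD; rewrite /paste; case: pickP => // a.
by rewrite (negPf (vD _ (fsvalP a))).
Qed.

Lemma paste_inside x u e D a : u \in U -> (D `<=` K)%fset -> a \in K ->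
  (a \notin D -> x (sg a u) = e a) -> paste x u e D (sg a u) = e a.
Proof.
move=> /sgU[_ _ inj] /fsubsetP DK aK xa; rewrite /paste.
case: pickP => [b /eqP|noD].
  by move=> /inj -> //; apply/DK/fsvalP.
by apply: xa; apply/negP => aD; have := noD [` aD]%fset; rewrite /= eqxx.
Qed.

Lemma model_global_local x e u b : u \in U -> b \in K ->
  {in N, forall n, x (sg (b * n)%g u) = e (b * n)%g} ->
  model_global x (sg b u) = F e b.
Proof.
move=> /sgU[_ act _] bK xe.
apply: ca_global_local => n nN; rewrite mul1g /pullback act ?xe //; exact: (fsubsetP NK).
Qed.

(** Pasting a configuration e' that differs from e on D only, at a place u where
    x looks like e around D, changes the induced image at the copies of cells b
    of G only, and there exactly as F e becomes F e'.  The point is that v sees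
    the copy of D only if sg n v = sg a u with a in D, n in N; since v is in U
    too, this can be inverted into v = sg (a n^-1) u. *)
Lemma model_global_paste x e e' u D v : u \in U -> v \in U ->
  (D `<=` K)%fset -> (affected A D `<=` K)%fset -> (halo A D `<=` K)%fset ->
  (forall g, g \notin D -> e' g = e g) ->
  {in halo A D, forall a, x (sg a u) = e a} ->
  model_global (paste x u e' D) v = model_global x v \/
  exists b, [/\ v = sg b u, model_global x v = F e b &
    model_global (paste x u e' D) v = F e' b].
Proof.
move=> uU vU DK aDK hDK e'D xe.
have [[n nN [a aD nv]]|noD] :=
  pselect (exists2 n, n \in N & exists2 a, a \in D & sg a u = sg n v); last first.
  left; apply: ca_global_local => n nN; rewrite mul1g /pullback.
  rewrite paste_outside // => a aD; apply/eqP => nv.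
  by apply: noD; exists n => //; exists a.
right; pose b := (a * n^-1)%g.
have bD : b \in affected A D by rewrite fset_mulgP ?fset_invgP.
have bK := fsubsetP aDK _ bD.
have bNK n' : n' \in N -> (b * n')%g \in K.
  by move=> n'N; apply/(fsubsetP hDK)/haloP.
have vb : v = sg b u.
  have [v1 vact _] := sgU vU; have [_ uact _] := sgU uU.
  have nK := fsubsetP NK _ nN; have nVK := fsubsetP NVK _ (fset_invgP nN).
  rewrite -uact //; last exact: (fsubsetP DK).
  by rewrite nv vact // mulgV v1.
exists b; split; rewrite // vb; apply: model_global_local => // n' n'N.
  by apply: xe; apply: haloP.
apply: paste_inside => //; first exact: bNK.
by move=> bn'D; rewrite e'D // xe //; apply: haloP.
Qed.

Lemma model_global_surjective (M : {fset G}) (y : V -> S) :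
  (M `<=` K)%fset -> (affected A M `<=` K)%fset -> (halo A M `<=` K)%fset ->
  corrects_within A M ->
  exists x, {in U, model_global x =1 y}.
Proof.
move=> MK aMK hMK corr.
have step (s : seq V) : {subset s <= U} ->
    exists x, {in s, model_global x =1 y}.
  elim: s => [|u s IH] sU; first by exists y.
  have uU : u \in U by apply: sU; rewrite mem_head.
  have [|x xy] := IH; first by move=> v vs; apply: sU; rewrite inE vs orbT.
  have [e' [e'M Fe']] := corr (pullback x u) (y u).
  exists (paste x u e' M) => v vs.
  have vU := sU v vs.
  have [uv|uv] := eqVneq v u.
    have [u1 _ _] := sgU uU.
    rewrite uv -[X in model_global _ X]u1.
    rewrite (@model_global_local _ e') //; first by rewrite Fe' eqxx.
    move=> n nN; rewrite mul1g; apply: paste_inside => //.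
      exact: (fsubsetP NK).
    by move=> /e'M ->.
  have {}vs : v \in s by move: vs; rewrite inE (negPf uv).
  rewrite -xy //.
  have [//|] := model_global_paste uU vU MK aMK hMK e'M (fun a _ => erefl).
  case=> b [vb -> ->]; rewrite Fe' ifN //; apply: contraNneq uv => b1.
  by rewrite vb b1; have [-> _ _] := sgU uU.
have [|x xy] := step (enum U); first by move=> v; rewrite mem_enum.
by exists x => v vU; apply: xy; rewrite mem_enum.
Qed.

(** If the window at u meets no window of a maximal disjoint family W, then u can
    be added to W; otherwise sg a w = sg b u for some w in W, and u is the copy
    of a b^-1 at w. *)
Lemma packing (P : {fset G}) : (P `<=` K)%fset ->
  (fset_invg P `<=` K)%fset -> (fset_mulg P (fset_invg P) `<=` K)%fset ->
  exists W : {set V},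
    [/\ W \subset U,
      {in W &, forall w w', w != w' -> forall a b, a \in P -> b \in P ->
         sg a w != sg b w'} &
      (#|U| <= #|W| * #|` K|)%N].
Proof.
move=> PK PVK PPK.
pose disj (W : {set V}) := `[< {in W &, forall w w', w != w' ->
   forall a b, a \in P -> b \in P -> sg a w != sg b w'} >].
pose ok (W : {set V}) := (W \subset U) && disj W.
have [|W /maxsetP[/andP[WU /asboolP Wd] Wmax]] := @maxset_exists _ ok set0.
  by rewrite /ok sub0set; apply/asboolP => w; rewrite inE.
exists W; split=> //.
have sub : U \subset [set sg (fsval ka.2) ka.1 | ka in setX W [set: K]].
  apply/subsetP => u uU.
  have [u1 uact _] := sgU uU.
  have [[w wW [a aP [b bP ab]]]|nomeet] := pselect (exists2 w, w \in W &
     exists2 a, a \in P & exists2 b, b \in P & sg a w = sg b u).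
    have wU := subsetP WU _ wW; have [_ wact _] := sgU wU.
    have aK := fsubsetP PK _ aP; have bK := fsubsetP PK _ bP.
    have bVK := fsubsetP PVK _ (fset_invgP bP).
    have abK : (a * b^-1)%g \in K.
      by apply/(fsubsetP PPK)/fset_mulgP => //; apply: fset_invgP.
    apply/imsetP; exists (w, [` abK]%fset); first by rewrite !inE wW.
    by rewrite /= -wact // ab uact // mulgV u1.
  have uW : u \in W.
    rewrite -(Wmax (u |: W)) ?setU11 ?subsetUr // /ok.
    rewrite subUset sub1set uU WU; apply/asboolP => w w'.
    rewrite !inE => /orP[/eqP ->|wW] /orP[/eqP ->|w'W].
    - by rewrite eqxx.
    - move=> _ a b aP bP; apply/eqP => ab; apply: nomeet.
      by exists w' => //; exists b => //; exists a.
    - move=> _ a b aP bP; apply/eqP => ab; apply: nomeet.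
      by exists w => //; exists a => //; exists b.
    - exact: Wd.
  by apply/imsetP; exists (u, [` K1]%fset); rewrite ?inE ?uW.
apply: leq_trans (subset_leq_card sub) _.
by apply: leq_trans (leq_imset_card _ _) _; rewrite cardsX cardsT -cardfE.
Qed.

(** Occurrences of c at the points of s are replaced by e one after the other.
    Replacing at w changes only the copy of D inside the window of w, so no
    occurrence reappears at the places already treated; as c and e differ on D,
    it does destroy the occurrence at w. *)
Lemma erase_pattern (D P : {fset G}) (c e : G -> S) (s : seq V) x :
  (P `<=` K)%fset -> (D `<=` P)%fset ->
  (affected A D `<=` K)%fset -> (halo A D `<=` P)%fset ->
  (forall g, (g \in D) = (c g != e g)) -> D != fset0 ->
  F c = F e ->
  uniq s -> {subset s <= U} ->
  {in s &, forall w w', w != w' -> forall a b, a \in P -> b \in P ->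
         sg a w != sg b w'} ->
  exists2 x', x' \in avoiders (fun w (a : P) => sg (fsval a) w)
                              (fun a => c (fsval a)) s
    & {in U, model_global x' =1 model_global x}.
Proof.
move=> PK DP aDK hDP DE D0 Fce.
have DK := fsubset_trans DP PK.
have hDK := fsubset_trans hDP PK.
elim: s => [|w s IH] /=.
  move=> _ _ _; exists [ffun v => x v]; rewrite ?inE // => v _.
  by congr (model_global _ _); apply: funext => v'; rewrite ffunE.
move=> /andP[ws us] sU sD.
have [||x' x's Fx'] := IH us.
- by move=> v vs; apply: sU; rewrite inE vs orbT.
- by move=> v v' vs v's; apply: sD; rewrite inE ?vs ?v's orbT.
have wU : w \in U by apply: sU; rewrite mem_head.
have [/forallP occ|nocc] :=
  boolP [forall a : P, x' (sg (fsval a) w) == c (fsval a)]; last first.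
  by exists x' => //; move: x's; rewrite !inE /= nocc.
have occP a : a \in P -> x' (sg a w) = c a.
  by move=> aP; apply/eqP/(occ [` aP]%fset).
pose x2 : {ffun V -> S} := [ffun v => paste x' w e D v].
have x2E : x2 = paste x' w e D :> (V -> S) by apply: funext => v; rewrite ffunE.
exists x2.
  move: x's; rewrite !inE /= => /allP x's; apply/andP; split.
    have /fset0Pn[a aD] := D0.
    apply/negP => /forallP /(_ [` fsubsetP DP _ aD]%fset).
    rewrite /= x2E paste_inside // ?aD //; last exact: (fsubsetP DK).
    by move: aD; rewrite DE eq_sym => /negPf ->.
  apply/allP => w' w's; have := x's _ w's; apply: contra => /forallP x2c.
  apply/forallP => a; have := x2c a; rewrite x2E paste_outside // => b bD.
  apply: sD; rewrite ?mem_head ?inE ?w's ?orbT //.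
  - by apply: contraNneq ws => ->.
  - exact: (fsubsetP DP).
move=> v vU; rewrite -Fx' // x2E.
have [||//|[b [vb -> ->]]] := @model_global_paste x' c e w D v wU vU DK aDK hDK.
- by move=> g; rewrite DE negbK => /eqP.
- by move=> a aD; apply: occP; apply: (fsubsetP hDP).
by rewrite Fce.
Qed.

End Model.

(** * Pre-injectivity over sofic groups *)

Lemma sofic_post_surjective_pre_injective (R : realType) (G : groupType)
    (S : finType) (A : cellular_automaton G S) :
  sofic R G -> post_surjective A -> pre_injective A.
Proof.
move=> sof Apost c e ce Fce; apply: contrapT => c_neq_e.
have [M corr] := correction_window Apost.
have [D DE] := asymptotic_support ce.
have D0 : D != fset0.
  apply: contra_notN c_neq_e => /eqP D0; apply: funext => g.
  by apply/eqP/negPn; rewrite -DE D0 in_fset0.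
set N := ca_nbhd A.
(* The halo alone misses D when the neighborhood is empty. *)
pose P := (D `|` halo A D)%fset.
pose K := ([fset 1%g] `|` (N `|` (fset_invg N `|` (M `|` (affected A M `|`
  (halo A M `|` (affected A D `|` (P `|` (fset_invg P `|`
  fset_mulg P (fset_invg P))))))))))%fset.
have : (K `<=` K)%fset := fsubset_refl K.
rewrite {1}/K !(@fsubUset _ K).
case/andP => K1 /andP[NK /andP[NVK /andP[MK /andP[aMK /andP[hMK]]]]].
case/andP => aDK /andP[PK /andP[PVK PPK]].
rewrite fsub1set in K1; rewrite -fsubUset -/P in PK.
have DP : (D `<=` P)%fset by apply: fsubsetUl.
have hDP : (halo A D `<=` P)%fset by apply: fsubsetUr.
have q1 := ca_states A; have q0 := ltnW q1.
set q := #|S| in q0 q1; pose Q := #|{ffun P -> S}|.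
have Q1 : (1 < Q)%N.
  rewrite /Q card_ffun -cardfE -(exp1n #|` P|) ltn_exp2r // cardfs_gt0.
  by have /fset0Pn[a aD] := D0; apply/fset0Pn; exists a; apply: (fsubsetP DP).
have [V [U [sg [sgU Ucard]]]] := sofic_locally_acts sof K (q * Q * #|` K|).
have [W [WU Wd Ucov]] := packing sgU K1 PK PVK PPK.
pose X := avoiders (fun w (a : P) => sg (fsval a) w) (fun a => c (fsval a)) (enum W).
have X_small : (#|X| * Q ^ #|W| <= q ^ #|V| * Q.-1 ^ #|W|)%N.
  have := @card_avoiders V P V S (fun w (a : P) => sg (fsval a) w)
    (fun a => c (fsval a)) (enum W) (enum_uniq _).
  rewrite -cardE [#|{ffun V -> S}|]card_ffun; apply.
    move=> w; rewrite mem_enum => /(subsetP WU)/sgU[_ _ inj] a b /inj ab.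
    by apply/val_inj/ab; apply: (fsubsetP PK); apply: fsvalP.
  move=> w w'; rewrite !mem_enum => wW w'W ww' a b.
  by apply: Wd => //; apply: fsvalP.
have X_large : (q ^ #|U| <= #|X|)%N.
  pose h (x : {ffun V -> S}) : {ffun {u | u \in U} -> S} :=
    [ffun u => model_global A sg x (val u)].
  have -> : (q ^ #|U| = #|{ffun {u | u \in U} -> S}|)%N.
    by rewrite card_ffun card_sig.
  rewrite -cardsT; apply: leq_trans (leq_imset_card h X).
  apply/subset_leq_card/subsetP => y _.
  (* Off U the target is arbitrary. *)
  pose y' v := if insub v is Some u then y u else c 1%g.
  have [x xy] := model_global_surjective sgU NK NVK K1 y' MK aMK hMK corr.
  have [||x' x'X Fx'] := @erase_pattern _ _ A _ _ _ _ sgU NK NVK D P c e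
      (enum W) x PK DP aDK hDP DE D0 Fce (enum_uniq _).
  - by move=> w; rewrite mem_enum => /(subsetP WU).
  - by move=> w w'; rewrite !mem_enum; apply: Wd.
  apply/imsetP; exists x' => //; apply/ffunP => u.
  by rewrite ffunE Fx' ?(valP u) // xy ?(valP u) // /y' valK.
have UV : (#|U| <= #|V|)%N by apply: max_card.
exact: (counting_contradiction q0 Q1 UV X_large X_small Ucov Ucard).
Qed.

Theorem theorem2 (R : realType) (G : groupType) (S : finType)
  (A : cellular_automaton G S) :
  sofic R G -> post_surjective A -> pre_injective A /\ reversible A.
Proof.
move=> sof Apost.
have Apre := sofic_post_surjective_pre_injective sof Apost.
by split=> //; apply: preinjective_reversible.
Qed.
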